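(* Let $F$ be a Riesz space equipped with a truncation $\tau_F$. The following are equivalent. (i) $\tau_F$ is Archimedean. (ii) For every Riesz space $E$ with a truncation $\tau_E$, every truncation homomorphism $T : E \to F$ is a Riesz homomorphism. (iii) For every Riesz space $E$ with a truncation $\tau_E$, every truncation homomorphism $T : E \to F$ is a positive operator. (iv) Every truncation homomorphism from $(D,\tau_D)$ into $(F,\tau_F)$ is a Riesz homomorphism. (v) Every truncation homomorphism from $(D,\tau_D)$ into $(F,\tau_F)$ is a positive operator.
   Context: All Riesz spaces are real. A truncation on a Riesz space $E$ is a map $\tau : E^{+} \to E^{+}$ such that $\tau(f) \wedge g = f \wedge \tau(g)$ for all $f, g \in E^{+}$. It is Archimedean if, for $f \in E^{+}$, $\tau(nf) = nf$ for all $n \in \mathbb{N}$ implies $f = 0$. The associated extended truncation is $\widetilde{\tau} : E \to E$, $\widetilde{\tau}(f) = \tau(f^{+}) - f^{-}$. A linear operator $T : E \to F$ between Riesz spaces with truncations $(E,\tau_E)$, $(F,\tau_F)$ is a truncation homomorphism if $T \circ \widetilde{\tau_E} = \widetilde{\tau_F} \circ T$. The test domain: let $u = (1, \tfrac12, \tfrac13, \dots) \in c_0^{+}$ and $D = \mathbb{R}u \oplus c_{00} \subseteq c_0$, where $c_{00}$ is the space of finitely supported real sequences. $D$ is a Riesz subspace of $c_0$, and $\tau_D(f) = f \wedge \mathbf{1}$ (pointwise meet with the constant sequence $\mathbf 1$) is a truncation on $D$. *)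

(* Defs.v *)
From HB Require Import structures.
From mathcomp Require Import all_boot all_order all_algebra.
From mathcomp Require Import all_classical reals.

Set Implicit Arguments.
Unset Strict Implicit.
Unset Printing Implicit Defensive.

Import Order.TTheory GRing.Theory Num.Theory.

Local Open Scope ring_scope.

(* A real vector space with a compatible partial order in which any two elements
   have an infimum and a supremum. HB cannot join Order.Lattice with a module
   structure at ring_display, so meet and join are given here by their universal
   properties; the Order.Lattice instance is derived from them below. *)
HB.mixin Record Lmodule_isRiesz (R : realType) E
    of GRing.Lmodule R E & Num.POrderedZmodule E := {
  riesz_leD2r : forall h f g : E, f <= g -> f + h <= g + h;
  riesz_scaler_ge0 : forall (a : R) (f : E), 0 <= a -> 0 <= f -> 0 <= a *: f;
  riesz_meet : E -> E -> E;
  riesz_join : E -> E -> E;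
  riesz_lexI : forall h f g : E,
    (h <= riesz_meet f g) = (h <= f) && (h <= g);
  riesz_leUx : forall h f g : E,
    (riesz_join f g <= h) = (f <= h) && (g <= h)
}.

#[short(type="rieszType")]
HB.structure Definition Riesz (R : realType) :=
  { E of GRing.Lmodule R E & Num.POrderedZmodule E
       & Lmodule_isRiesz R E }.

Section RieszLattice.
Variables (R : realType) (E : rieszType R).
Implicit Types f g h : E.

Let lexI h f g : (h <= riesz_meet f g) = (h <= f) && (h <= g).
Proof. exact: riesz_lexI. Qed.
Let leUx h f g : (riesz_join f g <= h) = (f <= h) && (g <= h).
Proof. exact: riesz_leUx. Qed.
Let leI1 f g : riesz_meet f g <= f.
Proof. by have := lexx (riesz_meet f g); rewrite lexI => /andP[]. Qed.
Let leI2 f g : riesz_meet f g <= g.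
Proof. by have := lexx (riesz_meet f g); rewrite lexI => /andP[]. Qed.
Let leU1 f g : f <= riesz_join f g.
Proof. by have := lexx (riesz_join f g); rewrite leUx => /andP[]. Qed.
Let leU2 f g : g <= riesz_join f g.
Proof. by have := lexx (riesz_join f g); rewrite leUx => /andP[]. Qed.

Let meetC : commutative (@riesz_meet R E).
Proof. by move=> f g; apply/le_anti; rewrite !lexI !leI1 !leI2. Qed.
Let joinC : commutative (@riesz_join R E).
Proof. by move=> f g; apply/le_anti; rewrite !leUx !leU1 !leU2. Qed.
Let meetA : associative (@riesz_meet R E).
Proof.
move=> f g h; apply/le_anti; rewrite !lexI !leI1 !leI2 /= !andbT.
by rewrite (le_trans (leI2 _ _) (leI1 _ _)) (le_trans (leI2 _ _) (leI2 _ _))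
  (le_trans (leI1 _ _) (leI1 _ _)) (le_trans (leI1 _ _) (leI2 _ _)).
Qed.
Let joinA : associative (@riesz_join R E).
Proof.
move=> f g h; apply/le_anti; rewrite !leUx !leU1 !leU2 /= !andbT.
by rewrite (le_trans (leU1 _ _) (leU1 _ _)) (le_trans (leU2 _ _) (leU1 _ _))
  (le_trans (leU1 _ _) (leU2 _ _)) (le_trans (leU2 _ _) (leU2 _ _)).
Qed.
Let joinKI g f : riesz_meet f (riesz_join f g) = f.
Proof. by apply/le_anti; rewrite leI1 lexI lexx leU1. Qed.
Let meetKU g f : riesz_join f (riesz_meet f g) = f.
Proof. by apply/le_anti; rewrite leU1 leUx lexx leI1. Qed.
Let leEmeet f g : (f <= g) = (riesz_meet f g == f).
Proof. by rewrite eq_le leI1 lexI lexx. Qed.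

HB.instance Definition _ := Order.POrder_isLattice.Build ring_display
  (Riesz.sort E) meetC joinC meetA joinA joinKI meetKU leEmeet.
End RieszLattice.

Section Truncations.
Context {R : realType}.
Implicit Types E F : rieszType R.

Definition pospart E (f : E) : E := (f `|` 0)%O.
Definition negpart E (f : E) : E := (- f `|` 0)%O.

(* A map of the positive cone is represented by a map on the whole space;
   its values outside the cone are irrelevant to all the notions below. *)
Definition is_truncation E (tau : E -> E) : Prop :=
  (forall f, 0 <= f -> 0 <= tau f) /\
  (forall f g, 0 <= f -> 0 <= g -> (tau f `&` g)%O = (f `&` tau g)%O).

Definition archimedean_truncation E (tau : E -> E) : Prop :=
  forall f, 0 <= f -> (forall n : nat, tau (f *+ n) = f *+ n) -> f = 0.

Definition extended_truncation E (tau : E -> E) (f : E) : E :=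
  tau (pospart f) - negpart f.

Definition truncation_homomorphism E F (tauE : E -> E) (tauF : F -> F)
    (T : {linear E -> F}) : Prop :=
  T \o extended_truncation tauE =1 extended_truncation tauF \o T.

Definition riesz_homomorphism E F (T : {linear E -> F}) : Prop :=
  Order.meet_morphism T /\ Order.join_morphism T.

Definition positive_operator E F (T : {linear E -> F}) : Prop :=
  forall f, 0 <= f -> 0 <= T f.

End Truncations.

Section TestDomain.
Variable R : realType.

(* R^o is R as a module over itself, which makes nat -> R^o an lmodType R for
   the pointwise operations; its lattice order is the pointwise one. *)
Local Notation seqR := (nat -> R^o).

Definition u_seq : seqR := fun n => n.+1%:R^-1.

Definition in_c00 (h : seqR) : Prop := finite_set [set n | h n != 0].

Definition D_pred : {pred seqR} :=
  fun f => `[< exists a h, in_c00 h /\ f = a *: u_seq + h >].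

Lemma in_c00P (h : seqR) :
  in_c00 h <-> exists N, forall n, (N <= n)%N -> h n = 0.
Proof.
split; last first.
  move=> [N hN]; apply: (sub_finite_set _ (finite_II N)) => n /= hn.
  by rewrite ltnNge; apply/negP => /hN /eqP; exact/negP.
move=> /finite_seqP[s hs]; exists (\max_(i <- s) i.+1)%N => n hn.
apply/eqP; apply: contraT => hn0.
have: [set` s]%classic n by rewrite -hs.
by move=> /= ns; move: hn; rewrite leqNgt (@leq_bigmax_seq _ s xpredT succn).
Qed.

Lemma D_predP (f : seqR) : reflect
  (exists a : R, exists N, forall n, (N <= n)%N -> f n = a * u_seq n)
  (f \in D_pred).
Proof.
apply: (iffP (asboolP _)) => [[a [h [/in_c00P[N hN] ->]]]|[a [N fN]]].
  exists a, N => n Nn.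
  by rewrite -[LHS]/(a * u_seq n + h n) hN // addr0.
exists a, (f - a *: u_seq); split; last by rewrite addrC subrK.
apply/in_c00P; exists N => n Nn.
by rewrite -[LHS]/(f n - a * u_seq n) fN // subrr.
Qed.

Lemma u_seq_ge0 n : 0 <= u_seq n.
Proof. by rewrite /u_seq invr_ge0. Qed.

Fact D_submod_closed : GRing.submod_closed D_pred.
Proof.
split=> [|b f g /D_predP[a [N fN]] /D_predP[c [M gM]]]; apply/D_predP.
  by exists 0, 0%N => n _; rewrite mul0r.
exists (b * a + c), (maxn N M) => n; rewrite geq_max => /andP[Nn Mn].
by rewrite -[LHS]/(b * f n + g n) fN // gM // mulrDl mulrA.
Qed.

HB.instance Definition _ :=
  GRing.isSubmodClosed.Build R seqR D_pred D_submod_closed.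

Fact D_meet_closed : {in D_pred &, forall f g, (f `&` g)%O \in D_pred}.
Proof.
move=> f g /D_predP[a [N fN]] /D_predP[c [M gM]]; apply/D_predP.
exists (Order.meet a c), (maxn N M) => n; rewrite geq_max => /andP[Nn Mn].
rewrite -[LHS]/(Order.meet (f n) (g n)) fN // gM // !meetEtotal.
by rewrite minr_pMl // u_seq_ge0.
Qed.

Fact D_join_closed : {in D_pred &, forall f g, (f `|` g)%O \in D_pred}.
Proof.
move=> f g /D_predP[a [N fN]] /D_predP[c [M gM]]; apply/D_predP.
exists (Order.join a c), (maxn N M) => n; rewrite geq_max => /andP[Nn Mn].
rewrite -[LHS]/(Order.join (f n) (g n)) fN // gM // !joinEtotal.
by rewrite maxr_pMl // u_seq_ge0.
Qed.

Record D : Type := MkD { D_val :> seqR; D_valP : D_val \in D_pred }.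

HB.instance Definition _ := [isSub for D_val].
HB.instance Definition _ := [Choice of D by <:].
HB.instance Definition _ := [SubChoice_isSubLmodule of D by <:].
HB.instance Definition _ := [SubChoice_isSubPOrder of D by <: with ring_display].

Lemma D_leP (f g : D) : reflect (forall n, f n <= g n) (f <= g).
Proof. by rewrite leEsub; exact: asboolP. Qed.

Fact D_leD2r (h f g : D) : f <= g -> f + h <= g + h.
Proof.
move=> /D_leP fg; apply/D_leP => n.
by rewrite -[leLHS]/(f n + h n) -[leRHS]/(g n + h n) lerD2r.
Qed.

Fact D_scaler_ge0 (a : R) (f : D) : 0 <= a -> 0 <= f -> 0 <= a *: f.
Proof.
move=> a0 /D_leP f0; apply/D_leP => n.
by rewrite -[leRHS]/(a * f n) mulr_ge0 //; exact: f0.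
Qed.

Definition D_meet (f g : D) : D := MkD (D_meet_closed (D_valP f) (D_valP g)).
Definition D_join (f g : D) : D := MkD (D_join_closed (D_valP f) (D_valP g)).

Fact D_lexI (h f g : D) : (h <= D_meet f g) = (h <= f) && (h <= g).
Proof. by rewrite !leEsub /= lexI. Qed.

Fact D_leUx (h f g : D) : (D_join f g <= h) = (f <= h) && (g <= h).
Proof. by rewrite !leEsub /= leUx. Qed.

HB.instance Definition _ :=
  Lmodule_isRiesz.Build R D D_leD2r D_scaler_ge0 D_lexI D_leUx.

Definition one_seq : seqR := fun=> 1.

Fact tau_D_subproof (f : D) : (D_val f `&` one_seq)%O \in D_pred.
Proof.
have /D_predP[a [N fN]] := D_valP f; apply/D_predP.
exists a, (maxn N (Num.truncn `|a|).+1) => n; rewrite geq_max => /andP[Nn an].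
rewrite -[LHS]/(Order.meet (f n) 1) fN // meetEtotal; apply/min_idPl.
rewrite /u_seq ler_pdivrMr ?ltr0n // mul1r.
rewrite (le_trans (ler_norm a)) // ltW // (lt_le_trans (truncnS_gt _)) //.
by rewrite ler_nat (leq_trans an).
Qed.

Definition tau_D (f : D) : D := MkD (tau_D_subproof f).

Lemma tau_D_truncation : is_truncation tau_D.
Proof.
split=> [f /D_leP f0|f g _ _].
  apply/D_leP => n.
  by rewrite -[leRHS]/(Order.meet (f n) 1) lexI ler01 andbT; exact: f0.
by apply: val_inj; rewrite /= -meetA [X in (_ `&` X)%O]meetC.
Qed.

End TestDomain.

(* Main.v *)
Require Import Defs.
From HB Require Import structures.
From mathcomp Require Import all_boot all_order all_algebra.
From mathcomp Require Import all_classical reals.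

(** The set of elements of [F^+] fixed by a truncation [tau] is downward closed
    and contains the range of [tau]; so [tau] is Archimedean iff no [w > 0] in
    [F] has all its multiples [n w] bounded by fixed elements
    ([archimedean_eq0]).

    Assume that [tauF] is Archimedean and let [T] be a truncation homomorphism.
    The extended truncation fixes the negative cone. Hence, for [f >= 0], it
    fixes [- n f], and so also [- n T f], whose positive part is [n (T f)^-];
    therefore [(T f)^- = 0], and [T] is positive. Now let [f] be arbitrary. As
    [T] is positive, [w = T (f^-) - (T f)^-] is nonnegative, and applying [T] to
    the extended truncation of [n f] gives
      [n w = T (tauE (n f^+)) - tauF (n (T f)^+)
           <= T (tauE (n f^+)) = tauF (n T (f^+))],
    so that [w = 0]. Thus [T] commutes with negative parts, and, since
    [f \/ g = g + (g - f)^-] and [f /\ g = f - (g - f)^-], it is a Riesz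
    homomorphism, which is in particular positive.

    Conversely, let [f >= 0] in [F] have all its multiples fixed by [tauF]. The
    extended truncation of [F] is then the identity on the line [R f]. Send
    [a u + h] in [D] to [- a f]. Truncating an element of [D] only alters
    finitely many of its terms, because [D] lies in [c_0], so it does not alter
    the coefficient [a], and this map is a truncation homomorphism. It maps
    [u >= 0] to [- f]; if it is positive then [f = 0]. *)

Set Implicit Arguments.
Unset Strict Implicit.
Unset Printing Implicit Defensive.

Import Order.TTheory GRing.Theory Num.Theory.

Local Open Scope ring_scope.

(** * Riesz space arithmetic *)

Section RieszSpaces.
Context {R : realType} {E : rieszType R}.
Implicit Types f g h : E.

Lemma riesz_lerD2r h f g : (f + h <= g + h) = (f <= g).
Proof.
apply/idP/idP => [|/(riesz_leD2r h)//].
by move=> /(riesz_leD2r (- h)); rewrite !addrK.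
Qed.

Lemma riesz_subr_ge0 f g : (0 <= f - g) = (g <= f).
Proof. by rewrite -(riesz_lerD2r g 0) add0r subrK. Qed.

Lemma riesz_oppr_ge0 f : (0 <= - f) = (f <= 0).
Proof. by rewrite -(riesz_subr_ge0 0 f) sub0r. Qed.

Lemma riesz_lerNl f g : (- f <= g) = (- g <= f).
Proof.
by rewrite -(riesz_subr_ge0 g) -(riesz_subr_ge0 f) !opprK addrC.
Qed.

Lemma riesz_lerN2 f g : (- f <= - g) = (g <= f).
Proof. by rewrite riesz_lerNl opprK. Qed.

Lemma riesz_mulrn_ge0 f n : 0 <= f -> 0 <= f *+ n.
Proof. by move=> f0; rewrite -scaler_nat riesz_scaler_ge0. Qed.

Lemma riesz_joinD2r h f g : ((f + h) `|` (g + h))%O = (f `|` g)%O + h.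
Proof.
apply/le_anti; rewrite leUx !riesz_lerD2r leUl leUr /=.
by rewrite -(riesz_lerD2r (- h) (_ + h)) addrK leUx -(riesz_lerD2r h f)
  -(riesz_lerD2r h g) !subrK leUl leUr.
Qed.

Lemma riesz_joinN f g : (- f `|` - g)%O = - (f `&` g)%O.
Proof.
apply/le_anti; rewrite leUx !riesz_lerN2 leIl leIr /= riesz_lerNl lexI.
by rewrite !(riesz_lerNl (_ `|` _)%O) leUl leUr.
Qed.

Lemma pospart_ge0 f : 0 <= pospart f.
Proof. exact: leUr. Qed.

Lemma negpart_ge0 f : 0 <= negpart f.
Proof. exact: leUr. Qed.

Lemma pospart_id f : 0 <= f -> pospart f = f.
Proof. by move=> /join_idPr; rewrite joinC. Qed.

Lemma pospart_eq0 f : f <= 0 -> pospart f = 0.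
Proof. by move=> /join_idPr. Qed.

Lemma pospartN f : pospart (- f) = negpart f.
Proof. by []. Qed.

Lemma pospartB f : pospart f - negpart f = f.
Proof.
apply/eqP; rewrite subr_eq addrC; apply/eqP.
by rewrite /negpart -riesz_joinD2r addNr add0r joinC.
Qed.

Lemma joinE_negpart f g : (f `|` g)%O = g + negpart (g - f).
Proof.
by rewrite /negpart opprB addrC -riesz_joinD2r subrK add0r.
Qed.

Lemma meetE_negpart f g : (f `&` g)%O = f - negpart (g - f).
Proof.
rewrite -[LHS]opprK -riesz_joinN joinC joinE_negpart opprD opprK.
by rewrite opprK [- f + g]addrC.
Qed.

(** One inequality is monotonicity; the other one is the same inequality for
    [a^-1]. *)
Lemma riesz_joinZ (a : R) f g : 0 <= a ->
  ((a *: f) `|` (a *: g))%O = a *: (f `|` g)%O.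
Proof.
have leZ (b : R) (x y : E) : 0 <= b -> x <= y -> b *: x <= b *: y.
  move=> b0 xy; rewrite -riesz_subr_ge0 -scalerBr riesz_scaler_ge0 //.
  by rewrite riesz_subr_ge0.
have joinZ_le (b : R) (x y : E) :
    0 <= b -> ((b *: x) `|` (b *: y))%O <= b *: (x `|` y)%O.
  by move=> b0; rewrite leUx !leZ ?leUl ?leUr.
rewrite le_eqVlt => /predU1P[<-|a0]; first by rewrite !scale0r joinxx.
apply/le_anti; rewrite joinZ_le ?(ltW a0) //=.
have a_neq0 := lt0r_neq0 a0; rewrite -[leRHS](scalerKV a_neq0).
apply: leZ (ltW a0) _.
have := joinZ_le a^-1 (a *: f) (a *: g).
by rewrite !scalerK // invr_ge0 ltW //; apply.
Qed.

Lemma pospartMn f n : pospart (f *+ n) = pospart f *+ n.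
Proof. by rewrite -!scaler_nat /pospart -riesz_joinZ ?scaler0. Qed.

Lemma negpartMn f n : negpart (f *+ n) = negpart f *+ n.
Proof. by rewrite -!pospartN -mulNrn pospartMn. Qed.

End RieszSpaces.

(** * Elements fixed by a truncation *)

Section FixedElements.
Context {R : realType} {E : rieszType R} {tau : E -> E}.
Hypothesis tau_trunc : is_truncation tau.
Implicit Types f g : E.

Lemma truncation_ge0 f : 0 <= f -> 0 <= tau f.
Proof. exact: tau_trunc.1. Qed.

Lemma truncation_le f : 0 <= f -> tau f <= f.
Proof.
move=> f0; have tf0 := truncation_ge0 f0.
by rewrite -[leLHS]meetxx tau_trunc.2 // leIl.
Qed.

Lemma truncation_fixed_le f g :
  0 <= f -> f <= g -> tau g = g -> tau f = f.
Proof.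
move=> f0 fg tg; apply/le_anti; rewrite truncation_le //=.
have g0 := le_trans f0 fg.
by rewrite -{1}(meet_idPl fg) -{1}tg -tau_trunc.2 // leIl.
Qed.

Lemma truncation_idem f : 0 <= f -> tau (tau f) = tau f.
Proof.
move=> f0; have tf0 := truncation_ge0 f0.
apply/le_anti; rewrite truncation_le //=.
by rewrite -{1}[tau f]meetxx -tau_trunc.2 // leIl.
Qed.

(** Fixed elements form a downward closed set, so it is enough to bound each
    multiple [n f] by one of them. This avoids computing [tau (n f)]. *)
Lemma archimedean_eq0 f : archimedean_truncation tau -> 0 <= f ->
  (forall n, exists2 g, tau g = g & f *+ n <= g) -> f = 0.
Proof.
move=> tau_arch f0 fle; apply: tau_arch => // n.
have [g tg fg] := fle n.
by apply: truncation_fixed_le fg tg; exact: riesz_mulrn_ge0.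
Qed.

Lemma extended_truncation_ge0 f : 0 <= f -> extended_truncation tau f = tau f.
Proof.
move=> f0; rewrite /extended_truncation pospart_id // -pospartN pospart_eq0.
  by rewrite subr0.
by rewrite riesz_lerNl oppr0.
Qed.

Lemma extended_truncation_le0 f : f <= 0 -> extended_truncation tau f = f.
Proof.
move=> f0; have tau0 : tau 0 = 0.
  by apply/le_anti; rewrite truncation_le // truncation_ge0.
by rewrite -[RHS]pospartB /extended_truncation pospart_eq0 // tau0.
Qed.

Lemma extended_truncation_fixed f :
  extended_truncation tau f = f -> tau (pospart f) = pospart f.
Proof. by move=> /eqP; rewrite -{2}(pospartB f) => /eqP/addIr. Qed.

(** For [a >= 0], [a f] lies below [n f] for some integer [n], hence is fixed;
    for [a < 0], [a f] lies in the negative cone. *)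
Lemma extended_truncation_line f (a : R) : 0 <= f ->
  (forall n, tau (f *+ n) = f *+ n) ->
  extended_truncation tau (a *: f) = a *: f.
Proof.
move=> f0 tf; have [a0|/ltW a0] := leP 0 a; last first.
  apply: extended_truncation_le0.
  by rewrite -riesz_oppr_ge0 -scaleNr riesz_scaler_ge0 // oppr_ge0.
have af0 : 0 <= a *: f by exact: riesz_scaler_ge0.
rewrite extended_truncation_ge0 //.
apply: (truncation_fixed_le af0 _ (tf (Num.truncn a).+1)).
rewrite -riesz_subr_ge0 -scaler_nat -scalerBl riesz_scaler_ge0 //.
by rewrite subr_ge0 ltW // truncnS_gt.
Qed.

End FixedElements.

(** * Truncation homomorphisms into an Archimedean truncation *)

Section TruncationHomomorphisms.
Context {R : realType} {E F : rieszType R} {tauE : E -> E} {tauF : F -> F}.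
Hypothesis tauE_trunc : is_truncation tauE.
Hypothesis tauF_trunc : is_truncation tauF.
Variable T : {linear E -> F}.

Lemma riesz_homomorphism_positive :
  riesz_homomorphism T -> positive_operator T.
Proof.
by move=> [_ Tjoin] f /pospart_id <-; rewrite Tjoin linear0 leUr.
Qed.

Lemma riesz_homomorphism_negpart :
  (forall f, T (negpart f) = negpart (T f)) -> riesz_homomorphism T.
Proof.
move=> Tneg; split=> f g.
  by rewrite !meetE_negpart linearB Tneg linearB.
by rewrite !joinE_negpart linearD Tneg linearB.
Qed.

Hypothesis tauF_arch : archimedean_truncation tauF.
Hypothesis T_hom : truncation_homomorphism tauE tauF T.

(** Every [- n f] is in the negative cone, where the extended truncation is the
    identity; so [- n (T f)] is fixed, and hence its positive part
    [n (T f)^-] is. *)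
Lemma truncation_homomorphism_positive : positive_operator T.
Proof.
move=> f f0; suff Tf0 : negpart (T f) = 0.
  by rewrite -[T f]pospartB Tf0 subr0 pospart_ge0.
apply: (archimedean_eq0 tauF_trunc tauF_arch (negpart_ge0 _)) => n.
exists (negpart (T f) *+ n) => //.
have := T_hom (- (f *+ n)); rewrite /= (extended_truncation_le0 tauE_trunc).
  move=> /esym/(extended_truncation_fixed).
  by rewrite linearN linearMn pospartN negpartMn.
by rewrite riesz_lerNl oppr0 riesz_mulrn_ge0.
Qed.

(** The defect [T (f^-) - (T f)^-] vanishes because [n] times it equals
    [tauF (T (n f^+)) - tauF (n (T f)^+)], which is below a value of [tauF]. *)
Lemma truncation_homomorphism_negpart f : T (negpart f) = negpart (T f).
Proof.
have Tpos := truncation_homomorphism_positive.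
have pf0 n : 0 <= pospart f *+ n by rewrite riesz_mulrn_ge0 ?pospart_ge0.
apply/eqP; rewrite -subr_eq0; apply/eqP.
apply: (archimedean_eq0 tauF_trunc tauF_arch).
  rewrite riesz_subr_ge0 leUx Tpos ?negpart_ge0 // andbT.
  by rewrite -linearN -riesz_subr_ge0 -linearB Tpos // riesz_subr_ge0 leUl.
move=> n; exists (tauF (T (pospart f *+ n))).
  by rewrite truncation_idem // Tpos.
have TtauE : T (tauE (pospart f *+ n)) = tauF (T (pospart f *+ n)).
  have := T_hom (pospart f *+ n).
  by rewrite /= !extended_truncation_ge0 ?Tpos.
have := T_hom (f *+ n).
rewrite /= /extended_truncation (linearMn T) !(pospartMn, negpartMn) linearB.
rewrite TtauE !(linearMn T) => eqn.
rewrite -riesz_subr_ge0 mulrnBl opprB addrCA eqn addrC subrK.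
by apply: truncation_ge0 => //; rewrite riesz_mulrn_ge0 ?pospart_ge0.
Qed.

Lemma truncation_homomorphism_riesz : riesz_homomorphism T.
Proof.
exact/riesz_homomorphism_negpart/truncation_homomorphism_negpart.
Qed.

End TruncationHomomorphisms.

(** * The coefficient of [u] as an obstruction on [D] *)

Section TailCoefficient.
Context {R : realType}.
Implicit Types d e : D R.

Definition tail_coef d : R := sval (cid (elimT (D_predP _) (D_valP d))).

Lemma tail_coefP d :
  exists N, forall n, (N <= n)%N -> d n = tail_coef d * u_seq R n.
Proof. exact: svalP (cid (elimT (D_predP _) (D_valP d))). Qed.

Lemma tail_coef_unique d (a : R) N :
  (forall n, (N <= n)%N -> d n = a * u_seq R n) -> tail_coef d = a.
Proof.
move=> dN; have [M dM] := tail_coefP d.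
have u0 : u_seq R (maxn N M) != 0 by rewrite invr_eq0 pnatr_eq0.
by apply: (mulIf u0); rewrite -dM ?leq_maxr // dN // leq_maxl.
Qed.

Lemma tail_coef_eq d e N :
  (forall n, (N <= n)%N -> d n = e n) -> tail_coef d = tail_coef e.
Proof.
move=> deN; have [M eM] := tail_coefP e.
apply: (@tail_coef_unique _ _ (maxn N M)) => n; rewrite geq_max => /andP[Nn Mn].
by rewrite deN // eM.
Qed.

Fact tail_coef_is_linear : linear (tail_coef : D R -> R^o).
Proof.
move=> b d e; have [N dN] := tail_coefP d; have [M eM] := tail_coefP e.
apply: (@tail_coef_unique _ _ (maxn N M)) => n; rewrite geq_max => /andP[Nn Mn].
by rewrite -[LHS]/(b * d n + e n) dN // eM // mulrDl mulrA.
Qed.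

(** The tail [a / (n + 1)] of an element of [D] tends to [0], so it is
    eventually at most [1]; at such indices the extended truncation changes nothing. *)
Lemma tail_coef_extended_truncation d :
  tail_coef (extended_truncation (@tau_D R) d) = tail_coef d.
Proof.
have truncR (x : R) : x <= 1 -> ((x `|` 0) `&` 1 - (- x `|` 0))%O = x.
  move=> x1; rewrite meet_l ?leUx ?x1 ?ler01 //.
  have [x0|/ltW x0] := leP 0 x.
    by rewrite join_r ?oppr_le0 // subr0.
  by rewrite join_l ?oppr_ge0 // sub0r opprK.
have [N dN] := tail_coefP d.
apply: (@tail_coef_eq _ _ (maxn N (Num.truncn `|tail_coef d|).+1)) => n.
rewrite geq_max => /andP[Nn an].
suff dn1 : d n <= 1 by exact: (truncR (d n)).
rewrite dN // /u_seq ler_pdivrMr ?ltr0n // mul1r.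
rewrite (le_trans (ler_norm _)) // ltW // (lt_le_trans (truncnS_gt _)) //.
by rewrite ler_nat (leq_trans an).
Qed.

Definition u_D : D R :=
  MkD (introT (D_predP (u_seq R))
    (ex_intro _ 1 (ex_intro _ 0 (fun n _ => esym (mul1r (u_seq R n)))))).

Lemma u_D_ge0 : 0 <= u_D.
Proof. by apply/D_leP => n; exact: u_seq_ge0. Qed.

Lemma tail_coef_u_D : tail_coef u_D = 1.
Proof. by apply: (@tail_coef_unique _ _ 0) => n _; rewrite mul1r. Qed.

(** The map [a u + h |-> - a f], which is a truncation homomorphism when all the
    multiples of [f] are fixed, and is positive only if [f <= 0]. *)
Definition neg_tail (F : rieszType R) (f : F) (d : D R) : F :=
  - tail_coef d *: f.

Fact neg_tail_is_linear (F : rieszType R) (f : F) : linear (neg_tail f).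
Proof.
move=> b d e; rewrite /neg_tail tail_coef_is_linear.
by rewrite opprD scalerDl -[b *: _]/(b * _) -mulrN scalerA.
Qed.

HB.instance Definition _ (F : rieszType R) (f : F) :=
  GRing.isLinear.Build R (D R) F *:%R (neg_tail f) (neg_tail_is_linear f).

Lemma neg_tail_truncation_homomorphism (F : rieszType R) (tauF : F -> F) f :
  is_truncation tauF -> 0 <= f -> (forall n, tauF (f *+ n) = f *+ n) ->
  truncation_homomorphism (@tau_D R) tauF (neg_tail f).
Proof.
move=> tauF_trunc f0 tf d /=.
by rewrite extended_truncation_line // /neg_tail tail_coef_extended_truncation.
Qed.

Lemma archimedean_of_D (F : rieszType R) (tauF : F -> F) :
  is_truncation tauF ->
  (forall T : {linear D R -> F},
    truncation_homomorphism (@tau_D R) tauF T -> positive_operator T) ->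
  archimedean_truncation tauF.
Proof.
move=> tauF_trunc Tpos f f0 tf; apply/le_anti; rewrite f0 andbT.
have := Tpos _ (neg_tail_truncation_homomorphism tauF_trunc f0 tf) _ u_D_ge0.
by rewrite /= /neg_tail tail_coef_u_D scaleN1r riesz_oppr_ge0.
Qed.

End TailCoefficient.

Theorem theorem3p17 (R : realType) (F : rieszType R) (tauF : F -> F)
    (tauF_trunc : is_truncation tauF) :
  [<->
    archimedean_truncation tauF;
    forall (E : rieszType R) (tauE : E -> E), is_truncation tauE ->
      forall T : {linear E -> F},
        truncation_homomorphism tauE tauF T -> riesz_homomorphism T;
    forall (E : rieszType R) (tauE : E -> E), is_truncation tauE ->
      forall T : {linear E -> F},
        truncation_homomorphism tauE tauF T -> positive_operator T;
    forall T : {linear D R -> F},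
      truncation_homomorphism (@tau_D R) tauF T -> riesz_homomorphism T;
    forall T : {linear D R -> F},
      truncation_homomorphism (@tau_D R) tauF T -> positive_operator T].
Proof.
tfae.
- by move=> tauF_arch E tauE tauE_trunc T; exact: truncation_homomorphism_riesz.
- move=> Triesz E tauE tauE_trunc T T_hom.
  exact/riesz_homomorphism_positive/(Triesz _ _ tauE_trunc).
(* Positivity for the domain [D] already gives the Archimedean property. *)
- move=> Tpos T; apply: truncation_homomorphism_riesz => //.
    exact: tau_D_truncation.
  by apply: archimedean_of_D => // S; apply: Tpos; exact: tau_D_truncation.
- by move=> Triesz T T_hom; exact/riesz_homomorphism_positive/Triesz.
- exact: archimedean_of_D.
Qed.
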